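(* Let $H_3=\langle a,b\mid[[a,b],a]=[[a,b],b]=e\rangle$ be the discrete Heisenberg group with the word length metric coming from the generating set $S=\{a,b,a^{-1},b^{-1}\}$, and let $c=[a,b]$. The following functions are Busemann points of $H_3$: \begin{align*} \eta^{\epsilon}_{m,n}(c^kb^ja^i)&:=-\epsilon i+|j-n|-|n|+2J\big(\epsilon(j-n),\,(j-n)i-(k-m)\big)-2J(-\epsilon n,m),\\ \zeta^{\epsilon}_{m,l}(c^kb^ja^i)&:=-\epsilon j+|i-l|-|l|+2J\big(-\epsilon(i-l),\,jl-(k-m)\big)-2J(\epsilon l,m), \end{align*} where $\epsilon\in\{-1,+1\}$, $m,n,l\in\mathbb{Z}$, and, for $u,v\in\mathbb{Z}$, $J(u,v):=1$ if $v\ne0$ and $uv\ge0$, and $J(u,v):=0$ otherwise. Together with the four functions $\xi^{++},\xi^{+-},\xi^{-+},\xi^{--}$, where $\xi^{\epsilon_a\epsilon_b}(c^zb^ya^x):=-\epsilon_ax-\epsilon_by$ for signs $\epsilon_a,\epsilon_b\in\{-1,+1\}$, these are the only Busemann points.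
   Context: $[x,y]=x^{-1}y^{-1}xy$, so $ab=bac$ and $c$ is central; every element of $H_3$ can be written uniquely as $c^kb^ja^i$ with $i,j,k\in\mathbb{Z}$. Word metric: $d(u,v)$ is the least $n$ such that $u^{-1}v$ is a product of $n$ elements of $S$. Horofunction boundary: for $z\in H_3$ let $\psi_z(x):=d(x,z)-d(e,z)$, where $e$ is the identity. The horofunction boundary is the closure of $\{\psi_z\}$ in the topology of pointwise convergence, minus $\{\psi_z\}$. A path $\gamma$ converges to $\xi$ if $\psi_{\gamma(t)}\to\xi$ pointwise as $t\to\infty$. A Busemann point is a limit of a geodesic path, i.e. of an isometric map $\gamma:\mathbb{N}\to H_3$, $\mathbb{N}=\{0,1,2,\dots\}$ (with arbitrary starting point). *)

(* Defs.v *)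
From HB Require Import structures.
From mathcomp Require Import all_boot all_order all_algebra.
From mathcomp Require Import all_classical all_reals all_analysis.
Import Order.TTheory GRing.Theory Num.Theory.
Import numFieldNormedType.Exports.

Set Implicit Arguments.
Unset Strict Implicit.
Unset Printing Implicit Defensive.

Local Open Scope classical_set_scope.
Local Open Scope ring_scope.

(* The presentation < a, b | [[a,b],a] = [[a,b],b] = e >, expressed by its
   universal property: it determines (G, a, b) up to a unique isomorphism.
   The library's [~ x, y] is x^-1 * y^-1 * x * y. *)
Definition heisenberg_relations (G : groupType) (a b : G) : Prop :=
  [~ [~ a, b], a]%g = 1%g /\ [~ [~ a, b], b]%g = 1%g.

Definition is_heisenberg_group (G : groupType) (a b : G) : Prop :=
  heisenberg_relations a b /\
  forall (K : groupType) (x y : K), heisenberg_relations x y ->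
    exists2 f : {multiplicative G -> K}, f a = x /\ f b = y &
      forall g : {multiplicative G -> K}, g a = x -> g b = y -> g =1 f.

Definition generators (G : groupType) (a b : G) : set G :=
  [set a; b; a^-1%g; b^-1%g].

Definition prod_of_length (G : groupType) (S : set G) (g : G) (n : nat) : Prop :=
  exists s : seq G,
    [/\ size s = n, (forall x, x \in s -> S x) & (\prod_(x <- s) x)%g = g].

(* The default value 0 is only used outside the submonoid generated by S. *)
Definition word_dist (G : groupType) (S : set G) (u v : G) : nat :=
  xget 0%N [set n | prod_of_length S (u^-1 * v)%g n /\
                    forall m, prod_of_length S (u^-1 * v)%g m -> (n <= m)%N].

Section Horofunctions.
Variables (R : realType) (G : groupType) (d : G -> G -> nat).

Definition psi (z : G) : {ptws G -> R} :=
  fun x => (d x z)%:R - (d 1%g z)%:R.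

Definition horofunction_boundary : set {ptws G -> R} :=
  closure (range psi) `\` range psi.

Definition path_converges_to (gamma : nat -> G) (xi : {ptws G -> R}) : Prop :=
  (fun t => psi (gamma t)) @ \oo --> xi.

Definition geodesic_path (gamma : nat -> G) : Prop :=
  forall s t : nat, d (gamma s) (gamma t) = `|s%:Z - t%:Z|%N.

Definition busemann_point (xi : {ptws G -> R}) : Prop :=
  horofunction_boundary xi /\
  exists2 gamma : nat -> G, geodesic_path gamma & path_converges_to gamma xi.

End Horofunctions.
Arguments psi R {G} d z.

Definition expgz (G : groupType) (x : G) (k : int) : G :=
  match k with Posz n => (x ^+ n)%g | Negz n => (x ^- n.+1)%g end.

(* c^k b^j a^i with c = [a,b] *)
Definition normal_form (G : groupType) (a b : G) (i j k : int) : G :=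
  (expgz [~ a, b] k * expgz b j * expgz a i)%g.

(* The (i, j, k) such that g = c^k b^j a^i; in the Heisenberg group it exists
   and is unique, so the choice and the default are immaterial. *)
Definition coords (G : groupType) (a b g : G) : int * int * int :=
  xget (0, 0, 0) [set p | g = normal_form a b p.1.1 p.1.2 p.2].

Definition J (u v : int) : int := if (v != 0) && (0 <= u * v) then 1 else 0.

Section Families.
Variables (R : realType) (G : groupType) (a b : G).

Definition eta_fun (eps m n : int) : {ptws G -> R} := fun g =>
  let: (i, j, k) := coords a b g in
  (- eps * i + `|j - n| - `|n|
   + 2 * J (eps * (j - n)) ((j - n) * i - (k - m)) - 2 * J (- eps * n) m)%:~R.

Definition zeta_fun (eps m l : int) : {ptws G -> R} := fun g =>
  let: (i, j, k) := coords a b g in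
  (- eps * j + `|i - l| - `|l|
   + 2 * J (- eps * (i - l)) (j * l - (k - m)) - 2 * J (eps * l) m)%:~R.

Definition xi_fun (eps_a eps_b : int) : {ptws G -> R} := fun g =>
  let: (x, y, _) := coords a b g in (- eps_a * x - eps_b * y)%:~R.

End Families.
Arguments eta_fun R {G} a b eps m n.
Arguments zeta_fun R {G} a b eps m l.
Arguments xi_fun R {G} a b eps_a eps_b.

Definition is_sign (eps : int) : Prop := eps = -1 \/ eps = 1.

(* Main.v *)
Require Import Defs.
From HB Require Import structures.
From mathcomp Require Import all_boot all_order all_algebra.
From mathcomp Require Import all_classical all_reals all_analysis.
From mathcomp Require Import zify ring lra.
Import Order.TTheory GRing.Theory Num.Theory.
Import numFieldNormedType.Exports.
Local Open Scope classical_set_scope.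
Local Open Scope ring_scope.

(** In the coordinates [(i, j, k)] of [c^k b^j a^i] a word is a lattice path
    from the origin to [(i, j)], and [k] is the area [\int x dy] that it
    sweeps. Word length is therefore the least length of a lattice path with
    given endpoint and given area. Only two facts about it are needed: a
    monotone path from the origin to [(i, j)] can have exactly the areas
    between [0] and [i * j] ([prod_of_length_lower], [reach_monotone]), and
    when [i] exceeds the absolute value of [k] an element whose area has the
    wrong sign costs two more letters ([wlen_far]).

    Which functions are limits of geodesics. Exchanging the two letters of a
    turn of a path changes its area by one, with a sign that depends on
    whether the turn is clockwise. If an infinite geodesic turns infinitely
    often in both ways, then its area can be altered at will by exchanges far
    along it. It then cannot contain a letter and a later inverse of this
    letter: deleting both and repairing the area would shorten it
    ([two_way_no_inverse]). So eventually it uses only two letters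
    [a^{+-1}] and [b^{+-1}], each infinitely often; all distances to it are
    eventually realized by monotone paths, and the limit is a [xi_fun]. If all
    late turns have the same direction, there are finitely many of them: on a
    spiral the exchanges alter the area in one direction, and letters moved
    between parallel sides of successive laps alter it in the other
    ([spiral_gain]), so the same contradiction arises ([no_spiral]). A geodesic
    that no longer turns is a straight ray, [wlen_far] computes its limit, and
    that limit is an [eta_fun] or a [zeta_fun] according to the direction.

    Conversely the straight rays [c^m b^n a^t] and the staircase
    [a b a b ...] are geodesics with the required limits. A limit of a geodesic
    is never one of the functions [psi z], since it is unbounded below.

    The pairs [(b, a)] and [(a^-1, b)] satisfy the same universal property as
    [(a, b)] and generate the same metric. They permute the three families, so
    one direction and one orientation represent all others. *)

Set Implicit Arguments.
Unset Strict Implicit.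

(** * Integer powers in a group *)

(** Going down by one is the converse of going up, so one equivalence serves
    both halves of an induction on [int]. *)
Lemma int_updown (P : int -> Prop) :
  P 0 -> (forall n, P n <-> P (n + 1)) -> forall n, P n.
Proof.
move=> P0 PS; elim/int_ind => [//|n Pn|n Pn].
- by have /PS := Pn; rewrite -PoszD addn1.
- by apply/PS; rewrite -addn1 PoszD opprD addrNK.
Qed.

Section IntegerPowers.
Variable G : groupType.
Implicit Types x y z : G.

Lemma expgzS x n : expgz x (n + 1) = (expgz x n * x)%g.
Proof.
case: n => [n|[|n]].
- have -> : Posz n + 1 = Posz n.+1 by lia.
  exact: expgSr.
- by rewrite /= mulVg.
- have -> : Negz n.+1 + 1 = Negz n by rewrite !NegzE; lia.
  by rewrite /= [(x ^+ n.+2)%g]expgS invgM -mulgA mulVg mulg1.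
Qed.

Lemma expgzD x m n : expgz x (m + n) = (expgz x m * expgz x n)%g.
Proof.
elim/int_updown: n => [|n]; first by rewrite addr0 mulg1.
rewrite addrA !expgzS mulgA.
by split=> [->|/mulIg].
Qed.

Lemma expgzM x m n : expgz x (m * n) = expgz (expgz x m) n.
Proof.
elim/int_updown: n => [|n]; first by rewrite mulr0.
rewrite mulrDr mulr1 expgzS (expgzD x).
by split=> [->|/mulIg].
Qed.

Lemma commute_expgz x y n : commute x y -> commute x (expgz y n).
Proof. by move=> cxy; case: n => n; [|apply: commuteV]; apply: commuteX. Qed.

Lemma expgz_swapr x y z n : (x * y = y * x * z)%g -> commute z y ->
  (x * expgz y n = expgz y n * x * expgz z n)%g.
Proof.
move=> xy zy; elim/int_updown: n => [|n]; first by rewrite /= !mulg1 mul1g.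
rewrite !expgzS.
have -> : (expgz y n * y * x * (expgz z n * z) =
           expgz y n * x * expgz z n * y)%g.
  rewrite -(mulgA _ (expgz z n)) -(commute_expgz n (commute_sym zy)).
  rewrite !mulgA -(mulgA _ x y) xy -!mulgA; congr (_ * (_ * (_ * _)))%g.
  exact: commute_sym (commute_expgz n (commute_refl z)).
rewrite mulgA.
by split=> [->|/mulIg].
Qed.

Lemma expgz_swapl x y z n : (x * y = y * x * z)%g -> commute z x ->
  (expgz x n * y = y * expgz x n * expgz z n)%g.
Proof.
move=> xy zx; elim/int_updown: n => [|n]; first by rewrite /= !mulg1 mul1g.
rewrite !expgzS.
have -> : (y * (expgz x n * x) * (expgz z n * z) =
           y * expgz x n * expgz z n * (x * z))%g.
  by rewrite !mulgA -(mulgA _ x) (commute_expgz n (commute_sym zx)) !mulgA.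
have -> : (expgz x n * x * y = expgz x n * y * (x * z))%g.
  by rewrite -!mulgA xy !mulgA.
by split=> [->|/mulIg].
Qed.

End IntegerPowers.

(** * The universal property *)

Section MorphismExtension.
Variables (G K : groupType) (f : G -> K).
Hypothesis fM : {morph f : x y / (x * y)%g}.

Lemma morph1 : f 1%g = 1%g.
Proof. by apply: (mulgI (f 1%g)); rewrite -fM !mulg1. Qed.

Lemma morphV : {morph f : x / x^-1%g}.
Proof. by move=> x; apply: (mulgI (f x)); rewrite -fM !mulgV morph1. Qed.

Lemma morph_heisenberg_relations a b :
  heisenberg_relations a b -> heisenberg_relations (f a) (f b).
Proof.
have fR x y : [~ f x, f y]%g = f [~ x, y]%g.
  by rewrite /commg /conjg !fM !morphV.
by move=> [ra rb]; split; rewrite !fR ?ra ?rb morph1.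
Qed.

End MorphismExtension.

(** Both morphisms have the images of [a] and [b] prescribed by the
    universal property. *)
Lemma heisenberg_morph_ext (G K : groupType) (a b : G) (f g : G -> K) :
  is_heisenberg_group a b ->
  {morph f : x y / (x * y)%g} -> {morph g : x y / (x * y)%g} ->
  f a = g a -> f b = g b -> f =1 g.
Proof.
move=> hG fM gM fga fgb x.
have [h _ huniq] := hG.2 _ _ _ (morph_heisenberg_relations fM hG.1).
pose F : {multiplicative G -> K} := HB.pack f
  (isMultiplicative.Build G K f fM).
pose H : {multiplicative G -> K} := HB.pack g
  (isMultiplicative.Build G K g gM).
have fh : f =1 h := huniq F erefl erefl.
have gh : g =1 h := huniq H (esym fga) (esym fgb).
by rewrite fh gh.
Qed.

(** * Coordinates on the Heisenberg group *)

(** The model: the third coordinate records the area [\int x dy], which is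
    where the term [i * j'] of the product comes from. *)
Definition heis : Type := (int * int * int)%type.
HB.instance Definition _ := Choice.on heis.

Definition heis_mul (u v : heis) : heis :=
  (u.1.1 + v.1.1, u.1.2 + v.1.2, u.2 + v.2 + u.1.1 * v.1.2).
Definition heis_inv (u : heis) : heis :=
  (- u.1.1, - u.1.2, - u.2 + u.1.1 * u.1.2).

Lemma heisP (u v : heis) : u.1.1 = v.1.1 -> u.1.2 = v.1.2 -> u.2 = v.2 -> u = v.
Proof. by case: u v => [[? ?] ?] [[? ?] ?] /= -> -> ->. Qed.

Fact heis_mulA : associative heis_mul.
Proof. by move=> u v w; apply: heisP => /=; ring. Qed.
Fact heis_mul1g : left_id ((0, 0, 0) : heis) heis_mul.
Proof. by move=> u; apply: heisP => /=; ring. Qed.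
Fact heis_mulg1 : right_id ((0, 0, 0) : heis) heis_mul.
Proof. by move=> u; apply: heisP => /=; ring. Qed.
Fact heis_mulVg : left_inverse ((0, 0, 0) : heis) heis_inv heis_mul.
Proof. by move=> u; apply: heisP => /=; ring. Qed.
Fact heis_mulgV : right_inverse ((0, 0, 0) : heis) heis_inv heis_mul.
Proof. by move=> u; apply: heisP => /=; ring. Qed.

HB.instance Definition _ := isGroup.Build heis
  heis_mulA heis_mul1g heis_mulg1 heis_mulVg heis_mulgV.

Definition heis_a : heis := (1, 0, 0).
Definition heis_b : heis := (0, 1, 0).

Lemma heis_relations : heisenberg_relations heis_a heis_b.
Proof. by split. Qed.

Lemma heis_normal_form i j k :
  normal_form heis_a heis_b i j k = (i, j, k).
Proof.
have ea n : expgz heis_a n = (n, 0, 0).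
  elim/int_updown: n => // n; rewrite expgzS; split=> [->|].
    by apply: heisP => /=; ring.
  by move: (expgz _ n) => [[p q] r] [] /= *; apply: heisP => /=; lia.
have eb n : expgz heis_b n = (0, n, 0).
  elim/int_updown: n => // n; rewrite expgzS; split=> [->|].
    by apply: heisP => /=; ring.
  by move: (expgz _ n) => [[p q] r] [] /= *; apply: heisP => /=; lia.
have ec n : expgz [~ heis_a, heis_b]%g n = (0, 0, n).
  elim/int_updown: n => // n; rewrite expgzS; split=> [->|].
    by apply: heisP => /=; ring.
  by move: (expgz _ n) => [[p q] r] [] /= *; apply: heisP => /=; lia.
by rewrite /normal_form ea eb ec; apply: heisP => /=; ring.
Qed.

Section Coordinates.
Variables (G : groupType) (a b : G).
Hypothesis hG : is_heisenberg_group a b.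

Let c := [~ a, b]%g.

Lemma comm_ca : commute c a.
Proof. by case: hG => -[/eqP/commgP]. Qed.

Lemma comm_cb : commute c b.
Proof. by case: hG => -[_ /eqP/commgP]. Qed.

Lemma normal_formM (u v : heis) :
  (normal_form a b u.1.1 u.1.2 u.2 * normal_form a b v.1.1 v.1.2 v.2)%g =
  let w := (u * v)%g in normal_form a b w.1.1 w.1.2 w.2.
Proof.
case: u v => [[i j] k] [[i' j'] k'] /=; rewrite /normal_form -/c.
have ab : (a * b = b * a * c)%g by exact: commgC.
have aibj : (expgz a i * expgz b j' =
             expgz b j' * expgz a i * expgz c (i * j'))%g.
  rewrite expgzM; apply: expgz_swapr.
    by apply: expgz_swapl; [exact: ab | exact: comm_ca].
  exact/commute_sym/commute_expgz/commute_sym/comm_cb.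
have ca n m : commute (expgz c n) (expgz a m).
  apply/commute_expgz/commute_sym/commute_expgz/commute_sym/comm_ca.
have cb n m : commute (expgz c n) (expgz b m).
  apply/commute_expgz/commute_sym/commute_expgz/commute_sym/comm_cb.
rewrite !expgzD -!mulgA; congr (_ * _)%g.
rewrite (mulgA (expgz a i)) -ca -!mulgA (mulgA (expgz b j)) -cb -!mulgA.
congr (_ * _)%g.
rewrite [in RHS]mulgA cb -!mulgA; congr (_ * _)%g.
rewrite [in RHS]mulgA cb -!mulgA [in RHS](mulgA _ (expgz a i)) ca.
by rewrite [in LHS]mulgA aibj -!mulgA.
Qed.

(** The universal property gives a morphism onto the model that names the
    generators, and [normal_form] is a morphism back; the composite is the
    identity because it fixes [a] and [b]. *)
Lemma coordinate_morphism :
  exists f : G -> heis,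
    [/\ {morph f : x y / (x * y)%g}, f a = heis_a, f b = heis_b,
        (forall g, normal_form a b (f g).1.1 (f g).1.2 (f g).2 = g) &
        (forall i j k, f (normal_form a b i j k) = (i, j, k))].
Proof.
have [f [fa fb] _] := hG.2 _ _ _ heis_relations.
have fM : {morph f : x y / (x * y)%g} by exact: gmulfM.
have fX x n : f (expgz x n) = expgz (f x) n.
  elim/int_updown: n => [|n]; first by rewrite /= morph1.
  by rewrite !expgzS fM; split=> [->|/mulIg].
pose nf (u : heis) := normal_form a b u.1.1 u.1.2 u.2.
exists f; split=> //.
- apply: (heisenberg_morph_ext (f := nf \o f) (g := idfun) hG) => //=.
  + by move=> x y; rewrite /= fM /nf normal_formM.
  + by rewrite fa /nf /normal_form /= !mul1g.
  + by rewrite fb /nf /normal_form /= mul1g mulg1.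
- by move=> i j k; rewrite /normal_form !fM !fX /commg /conjg !fM !morphV//
    fa fb -heis_normal_form.
Qed.

(** [coords] with values in the group [heis], where it is a morphism. *)
Definition co (g : G) : heis := coords a b g.

Lemma coP :
  [/\ {morph co : x y / (x * y)%g}, co a = heis_a, co b = heis_b,
      cancel co (fun u => normal_form a b u.1.1 u.1.2 u.2) &
      (forall i j k, co (normal_form a b i j k) = (i, j, k))].
Proof.
have [f [fM fa fb fK Kf]] := coordinate_morphism.
suff /funext -> : co =1 f by split.
move=> g; apply: xget_unique => [|u /= gE]; first by rewrite /= fK.
by rewrite gE Kf -!surjective_pairing.
Qed.

Lemma coM x y : co (x * y)%g = (co x * co y)%g. Proof. by case: coP. Qed.

Lemma co_a : co a = heis_a. Proof. by case: coP. Qed.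

Lemma co_b : co b = heis_b. Proof. by case: coP. Qed.

Lemma coK : cancel co (fun u => normal_form a b u.1.1 u.1.2 u.2).
Proof. by case: coP. Qed.

Lemma co_normal_form i j k : co (normal_form a b i j k) = (i, j, k).
Proof. by case: coP. Qed.

Lemma co1 : co 1%g = 1%g. Proof. exact: morph1 coM. Qed.

Lemma coV x : co x^-1%g = (co x)^-1%g. Proof. exact: morphV coM x. Qed.

End Coordinates.

(** * Word length *)

Definition wlen (G : groupType) (a b : G) (g : G) : nat :=
  word_dist (generators a b) 1%g g.

Section Products.
Variables (G : groupType) (S : set G).
Local Notation prodlen := (prod_of_length S).

Lemma prod_of_length1 : prodlen 1%g 0.
Proof. by exists [::]; split=> //; rewrite big_nil. Qed.

Lemma prod_of_lengthM g h m n :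
  prodlen g m -> prodlen h n -> prodlen (g * h)%g (m + n).
Proof.
move=> [s [sm sS <-]] [t [tn tS <-]]; exists (s ++ t).
split; first by rewrite size_cat sm tn.
  by move=> x; rewrite mem_cat => /orP[/sS|/tS].
by rewrite big_cat.
Qed.

Lemma prod_of_length_gen x : S x -> prodlen x 1.
Proof.
by move=> Sx; exists [:: x]; split=> [//|y|]; rewrite ?big_seq1// inE => /eqP->.
Qed.

Lemma prod_of_length0 g : prodlen g 0 -> g = 1%g.
Proof. by move=> [s [/size0nil-> _ <-]]; rewrite big_nil. Qed.

Lemma prod_of_lengthS g n : prodlen g n.+1 ->
  exists h x, [/\ prodlen h n, S x & g = (h * x)%g].
Proof.
move=> [s]; case/lastP: s => [|s x] [].
  by [].
rewrite size_rcons => -[sn] sS <-; exists (\prod_(y <- s) y)%g, x; split.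
- by exists s; split=> // y ys; apply: sS; rewrite mem_rcons inE ys orbT.
- by apply: sS; rewrite mem_rcons mem_head.
- by rewrite -cats1 big_cat big_seq1.
Qed.

Lemma prod_of_lengthV g n : (forall x, S x -> S x^-1%g) ->
  prodlen g n -> prodlen g^-1%g n.
Proof.
move=> SV; elim: n g => [|n IH] g.
  by move=> /prod_of_length0->; rewrite invg1; apply: prod_of_length1.
move=> /prod_of_lengthS[h [x [/IH hn /SV Sx ->]]]; rewrite invgM -add1n.
by apply: prod_of_lengthM => //; apply: prod_of_length_gen.
Qed.

End Products.

Lemma swap_generators (G : groupType) (a b : G) :
  generators b a = generators a b.
Proof.
by apply/seteqP; split=> x [[[]|]|] ->; rewrite /generators /=; tauto.
Qed.

Lemma invl_generators (G : groupType) (a b : G) :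
  generators a^-1%g b = generators a b.
Proof.
by apply/seteqP; split=> x [[[]|]|] ->; rewrite /generators /= ?invgK; tauto.
Qed.

Lemma generatorsV (G : groupType) (a b : G) x :
  generators a b x -> generators a b x^-1%g.
Proof. by move=> [[[]|]|] ->; rewrite /generators /= ?invgK; tauto. Qed.

Section WordLength.
Variables (G : groupType) (a b : G).
Hypothesis hG : is_heisenberg_group a b.

Local Notation S := (generators a b).
Local Notation prodlen := (prod_of_length S).
Local Notation co := (co a b).
Local Notation wlen := (wlen a b).

Lemma prod_of_length_exists g : exists n, prodlen g n.
Proof.
have PM x y : (exists n, prodlen x n) -> (exists n, prodlen y n) ->
    exists n, prodlen (x * y)%g n.
  by move=> [m xm] [n yn]; exists (m + n)%N; apply: prod_of_lengthM.
have PV x : (exists n, prodlen x n) -> exists n, prodlen x^-1%g n.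
  move=> [n xn]; exists n; apply: prod_of_lengthV xn => y; exact: generatorsV.
have PX x k : (exists n, prodlen x n) -> exists n, prodlen (expgz x k) n.
  move=> xP; elim/int_updown: k => [|k].
    by exists 0%N; apply: prod_of_length1.
  rewrite expgzS; split=> [kP|kP]; first exact: PM.
  by rewrite -(mulgK x (expgz x k)); apply/PM/PV.
have Pa : exists n, prodlen a n.
  by exists 1%N; apply: prod_of_length_gen; rewrite /generators /=; tauto.
have Pb : exists n, prodlen b n.
  by exists 1%N; apply: prod_of_length_gen; rewrite /generators /=; tauto.
rewrite -(coK hG g); apply: (PM); last exact: PX.
apply: (PM); apply: PX => //.
by rewrite /commg /conjg; apply/PM; [|apply/PM; [|apply/PM]] => //; apply: PV.
Qed.

Lemma wlenP g : prodlen g (wlen g) /\ forall m, prodlen g m -> (wlen g <= m)%N.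
Proof.
rewrite /wlen /word_dist invg1 mul1g.
pose P := [set n | prodlen g n /\ forall m, prodlen g m -> (n <= m)%N].
suff : P (xget 0%N P) by []; apply: xgetPex.
have [n gn] := prod_of_length_exists g.
have ex : exists n, `[< prodlen g n >] by exists n; apply/asboolP.
exists (ex_minn ex); case: ex_minnP => m /asboolP gm mmin.
by split=> // p gp; apply/mmin/asboolP.
Qed.

Lemma word_distE u v : word_dist S u v = wlen (u^-1 * v)%g.
Proof. by rewrite /wlen /word_dist invg1 mul1g. Qed.

Lemma wlen_le g n : prodlen g n -> (wlen g <= n)%N.
Proof. by case: (wlenP g) => _; apply. Qed.

Lemma wlen1 : wlen 1%g = 0%N.
Proof. by have := wlen_le (prod_of_length1 S); lia. Qed.

Lemma wlenM g h : (wlen (g * h)%g <= wlen g + wlen h)%N.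
Proof. by apply/wlen_le/prod_of_lengthM; [case: (wlenP g)|case: (wlenP h)]. Qed.

Lemma wlenV g : wlen g^-1%g = wlen g.
Proof.
have le x : (wlen x^-1%g <= wlen x)%N.
  apply/wlen_le/prod_of_lengthV; last by case: (wlenP x).
  exact: generatorsV.
by apply/eqP; rewrite eqn_leq le -{1}[g]invgK le.
Qed.

Lemma wlen_gen x : S x -> (wlen x <= 1)%N.
Proof. by move=> Sx; apply/wlen_le/prod_of_length_gen. Qed.

Lemma wlen_eq1 x : wlen x = 1%N -> S x.
Proof.
move=> x1; have [+ _] := wlenP x; rewrite x1.
by move=> /prod_of_lengthS[h [y [/prod_of_length0-> Sy ->]]]; rewrite mul1g.
Qed.

Lemma co_generators x : S x ->
  [\/ co x = (1, 0, 0), co x = (0, 1, 0), co x = (-1, 0, 0) |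
      co x = (0, -1, 0)].
Proof.
move=> [[[]|]|] ->; rewrite ?coV ?co_a ?co_b//.
- by apply: Or41.
- by apply: Or42.
- by apply: Or43.
- by apply: Or44.
Qed.

(** A word of length less than [`|i| + `|j| + 2] never uses a letter together
    with its inverse. It is a monotone lattice path, and a monotone path
    sweeps an area between [0] and [i * j]. *)
Lemma prod_of_length_lower g n i j k : prodlen g n -> co g = (i, j, k) ->
  `|i| + `|j| <= n%:Z /\
  (n%:Z < `|i| + `|j| + 2 -> 0 <= k <= i * j \/ i * j <= k <= 0).
Proof.
elim: n g i j k => [|n IH] g i j k.
  move=> /prod_of_length0->; rewrite co1// => -[<- <- <-].
  by split=> // _; left.
move=> /prod_of_lengthS[h [x [/IH + Sx ->]]].
case E : (co h) => [[i' j'] k'] /(_ _ _ _ erefl)[len sgn].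
rewrite coM// E; case: (co_generators Sx) => -> -[<- <- <-] /=;
  rewrite !(addr0, mulr0, mulr1, mulrN1); (split; first lia) => lt.
- have i0 : 0 <= i' by lia.
  have {}sgn : 0 <= k' <= i' * j' \/ i' * j' <= k' <= 0 by apply: sgn; lia.
  rewrite mulrDl mul1r.
  have [j0|j0] := lerP 0 j'.
    have ij := mulr_ge0 i0 j0; left; lia.
  have ij := mulr_ge0_le0 i0 (ltW j0); right; lia.
- have j0 : 0 <= j' by lia.
  have {}sgn : 0 <= k' <= i' * j' \/ i' * j' <= k' <= 0 by apply: sgn; lia.
  rewrite mulrDr mulr1.
  have [i0|i0] := lerP 0 i'.
    have ij := mulr_ge0 i0 j0; left; lia.
  have ij := mulr_le0_ge0 (ltW i0) j0; right; lia.
- have i0 : i' <= 0 by lia.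
  have {}sgn : 0 <= k' <= i' * j' \/ i' * j' <= k' <= 0 by apply: sgn; lia.
  rewrite mulrBl mul1r.
  have [j0|j0] := lerP 0 j'.
    have ij := mulr_le0_ge0 i0 j0; right; lia.
  have ij := mulr_le0 i0 (ltW j0); left; lia.
- have j0 : j' <= 0 by lia.
  have {}sgn : 0 <= k' <= i' * j' \/ i' * j' <= k' <= 0 by apply: sgn; lia.
  rewrite mulrBr mulr1.
  have [i0|i0] := lerP 0 i'.
    have ij := mulr_ge0_le0 i0 j0; right; lia.
  have ij := mulr_le0 (ltW i0) j0; left; lia.
Qed.

Definition reach (n : nat) (i j k : int) : Prop :=
  (wlen (normal_form a b i j k) <= n)%N.

Lemma reachP n i j k g : co g = (i, j, k) -> reach n i j k <-> (wlen g <= n)%N.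
Proof. by move=> gE; rewrite /reach -[in X in _ <-> X](coK hG g) gE. Qed.

Lemma reachM m n i j k i' j' k' : reach m i j k -> reach n i' j' k' ->
  reach (m + n) (i + i') (j + j') (k + k' + i * j').
Proof.
move=> le le'; apply/(@reachP _ _ _ _
  (normal_form a b i j k * normal_form a b i' j' k')%g).
  by rewrite coM// !co_normal_form.
by apply: leq_trans (wlenM _ _) _; apply: leq_add.
Qed.

Lemma reach0 : reach 0 0 0 0.
Proof. by apply/(@reachP _ _ _ _ 1%g); rewrite ?co1// wlen1. Qed.

Lemma reach_a : reach 1 1 0 0.
Proof.
apply/(@reachP _ _ _ _ a); rewrite ?co_a//.
by apply: wlen_gen; rewrite /generators /=; tauto.
Qed.

Lemma reach_b : reach 1 0 1 0.
Proof.
apply/(@reachP _ _ _ _ b); rewrite ?co_b//.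
by apply: wlen_gen; rewrite /generators /=; tauto.
Qed.

Lemma reachV n i j k : reach n i j k -> reach n (- i) (- j) (- k + i * j).
Proof.
move=> le; apply/(@reachP _ _ _ _ (normal_form a b i j k)^-1%g).
  by rewrite coV// co_normal_form.
by rewrite wlenV.
Qed.

Lemma reach_aX n m i j k (e : int) : e = 1 \/ e = -1 -> reach n i j k ->
  reach (n + m) (i + e * m%:Z) j k.
Proof.
move=> e1 r; elim: m => [|m IH]; first by rewrite addn0 mulr0 addr0.
have r1 : reach 1 e 0 0.
  by case: e1 => ->; [exact: reach_a | have := reachV reach_a].
have := reachM IH r1; rewrite mulr0 !addr0 addn1 addnS.
by congr (reach _ _ _ _); lia.
Qed.

Lemma reach_bX n m i j k (e : int) : e = 1 \/ e = -1 -> reach n i j k ->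
  reach (n + m) i (j + e * m%:Z) (k + i * (e * m%:Z)).
Proof.
move=> e1 r; elim: m => [|m IH]; first by rewrite addn0 !mulr0 !addr0.
have r1 : reach 1 0 e 0.
  by case: e1 => ->; [exact: reach_b | have := reachV reach_b].
have := reachM IH r1; rewrite !addr0 addn1 addnS.
by congr (reach _ _ _ _); lia.
Qed.

(** Conversely every area between [0] and [i * j] is swept by a monotone
    path: end with a vertical step when the area is at least the final
    abscissa, with a horizontal one otherwise. *)
Lemma reach_monotone n i j k (e : int) : e = 1 \/ e = -1 ->
  0 <= i -> 0 <= j -> 0 <= k <= i * j -> i + j = n%:Z ->
  reach n i (e * j) (e * k).
Proof.
move=> e1; elim: n i j k => [|n IH] i j k i0 j0 kij ijn.
  have [-> -> ->] : [/\ i = 0, j = 0 & k = 0] by split; nia.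
  by rewrite mulr0; apply: reach0.
have [ik|ki] := lerP i k; last first.
  have := @reach_aX n 1 (i - 1) (e * j) (e * k) 1 (or_introl erefl).
  rewrite addn1 mulr1 subrK; apply; apply: IH; [lia|lia|nia|lia].
have [j1|j1] := lerP 1 j; last first.
  have j00 : j = 0 by lia.
  have k00 : k = 0 by nia.
  have := @reach_aX n 1 (i - 1) (e * j) (e * k) 1 (or_introl erefl).
  rewrite addn1 mulr1 subrK; apply; apply: IH; [lia|lia|nia|lia].
have := @reach_bX n 1 i (e * (j - 1)) (e * (k - i)) e e1.
rewrite addn1 mulr1.
have -> : e * (j - 1) + e = e * j by ring.
have -> : e * (k - i) + i * e = e * k by ring.
by apply; apply: IH; [lia|lia|nia|lia].
Qed.

Lemma wlen_monotone g i j k : co g = (i, j, k) -> 0 <= i -> 0 <= j ->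
  0 <= k <= i * j -> (wlen g)%:Z = i + j.
Proof.
move=> gE i0 j0 kij.
have [le _] := prod_of_length_lower (wlenP g).1 gE.
have := @reach_monotone `|(i + j)%R|%N i j k 1 (or_introl erefl) i0 j0 kij.
rewrite !mul1r => /(_ ltac:(lia)) /(reachP _ gE); lia.
Qed.

(** Far out in the direction of [a], the only obstruction to a monotone path
    is the sign of the area. It is overcome by one vertical step on the wrong
    side, undone at abscissa [i], which shifts the area by [i]. *)
Lemma wlen_far g i j k : co g = (i, j, k) -> `|k| < i ->
  (wlen g)%:Z = i + `|j| + 2 * J (- j) k.
Proof.
move=> gE ki.
have [le sgn] := prod_of_length_lower (wlenP g).1 gE.
rewrite /J; case: ifPn => [/andP[k0 jk]|].
- have {sgn} : ~ ((wlen g)%:Z < `|i| + `|j| + 2).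
    by move=> /sgn; nia.
  (* [e] is the direction of the extra vertical step. *)
  pose e : int := if k < 0 then 1 else -1.
  have e1 : e = 1 \/ e = -1 by rewrite /e; case: ifP; [left|right].
  have ek : e * k <= 0 by rewrite /e; case: ifP; lia.
  have ejj : e * `|j| = j by rewrite /e; case: ifP; nia.
  have ekk : e * (e * k) = k by case: e1 => ->; lia.
  have := @reach_monotone `|(i + `|j| + 1)%R|%N i (`|j| + 1) (e * k + i) e e1.
  move=> /(_ ltac:(lia) ltac:(lia)).
  (* The path first goes one step too far vertically, with area [e * k + i]. *)
  have kb : 0 <= e * k + i <= i * (`|j| + 1) by case: e1 ek => ->; nia.
  move=> /(_ kb ltac:(lia)).
  have eN : - e = 1 \/ - e = -1 by lia.
  move=> /(reach_bX 1 eN); rewrite (mulr1 (- e)) addn1.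
  have -> : e * (`|j| + 1) - e = j by rewrite -[RHS]ejj; ring.
  have -> : e * (e * k + i) + i * - e = k by rewrite -[RHS]ekk; ring.
  by move=> /(reachP _ gE); lia.
- rewrite negb_and negbK -ltNge mulNr oppr_lt0 => jk.
  pose e : int := if 0 <= j then 1 else -1.
  have e1 : e = 1 \/ e = -1 by rewrite /e; case: ifP; [left|right].
  have ejj : e * `|j| = j by rewrite /e; case: ifP; lia.
  have ekk : e * (e * k) = k by case: e1 => ->; lia.
  have kb : 0 <= e * k <= i * `|j|.
    case/orP: jk => [/eqP->|jk]; first by rewrite mulr0; nia.
    have ij : i * 1 <= i * `|j| by apply: ler_wpM2l; nia.
    by rewrite /e; case: ifP => j0; apply/andP; split; nia.
  have := @reach_monotone `|(i + `|j|)%R|%N i `|j| (e * k) e e1.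
  move=> /(_ ltac:(lia) ltac:(lia) kb ltac:(lia)).
  by rewrite ejj ekk => /(reachP _ gE); lia.
Qed.

End WordLength.

(** * Geodesics and their limits *)

Lemma diverges_of_increments (q : nat -> int) N :
  (forall t, (N <= t)%N -> q t <= q t.+1) ->
  (forall M, exists2 t, (M <= t)%N & q t < q t.+1) ->
  forall B : int, exists T, forall t, (T <= t)%N -> B <= q t.
Proof.
move=> mono inc B.
have monoD T s : (N <= T)%N -> q T <= q (T + s)%N.
  move=> NT; elim: s => [|s IH]; first by rewrite addn0.
  by rewrite addnS; apply: le_trans IH (mono _ _); lia.
have large n : exists2 T, (N <= T)%N & q N + n%:Z <= q T.
  elim: n => [|n [T NT qT]]; first by exists N => //; rewrite addr0.
  have [t Tt qt] := inc T; exists t.+1; first by lia.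
  have := monoD T (t - T)%N NT; rewrite subnKC//; lia.
have [T NT qT] := large `|(B - q N)%R|%N.
exists T => t Tt; have := monoD T (t - T)%N NT; rewrite subnKC//; lia.
Qed.

Section Limits.
Variables (R : realType) (G : groupType) (a b : G).
Hypothesis hG : is_heisenberg_group a b.

Local Notation d := (word_dist (generators a b)).
Local Notation co := (co a b).
Local Notation wlen := (wlen a b).

(** The metric is integer valued, so pointwise convergence is eventual
    equality at each point. *)
Definition eventually_psi (gamma : nat -> G) (f : {ptws G -> R}) : Prop :=
  forall x, exists T, forall t, (T <= t)%N -> psi R d (gamma t) x = f x.

Lemma eventually_psi_cvg gamma f :
  eventually_psi gamma f -> path_converges_to d gamma f.
Proof.
move=> ev; apply/cvg_sup => x A [B [[C oC <-] Cfx] BA].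
by have [T evT] := ev x; exists T => // t Tt; apply: BA; rewrite /= evT.
Qed.

Lemma path_converges_pointwise gamma f x :
  path_converges_to d gamma f ->
  (psi R d (gamma t) x : R) @[t --> \oo] --> (f x : R).
Proof.
move=> cv; apply: (cvg_comp _ (@proj G (fun=> R : topologicalType) x) cv).
exact: (@proj_continuous G (fun=> R : topologicalType) x f).
Qed.

Lemma eventually_psi_unique gamma f g :
  path_converges_to d gamma f -> eventually_psi gamma g -> f = g.
Proof.
move=> cv ev; apply/funext => x.
apply: (cvg_unique (@Rhausdorff R) (path_converges_pointwise cv)).
have [T evT] := ev x.
by apply: cvg_near_cst; exists T.
Qed.

Lemma geodesic_wlen gamma s t : geodesic_path d gamma -> (s <= t)%N ->
  wlen ((gamma s)^-1 * gamma t)%g = (t - s)%N.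
Proof. by move=> geo st; rewrite -word_distE geo; lia. Qed.

(** Along a geodesic the limit tends to minus infinity, whereas every
    [psi z] is bounded below. *)
Lemma geodesic_limit_boundary gamma (f : {ptws G -> R}) :
  geodesic_path d gamma ->
  path_converges_to d gamma f -> horofunction_boundary d f.
Proof.
move=> geo cv; split.
  move=> B /cv[T _ TB]; exists (psi R d (gamma T)).
  by split; [exists (gamma T) | apply: TB => /=].
move=> [z _ fz].
pose s := (wlen (gamma 0%N) + wlen z + 1)%N.
have : f (gamma s) <= (wlen (gamma 0%N))%:R - s%:R.
  apply: (closed_cvg _ (@closed_le _ _) _ _ (path_converges_pointwise cv)).
  exists s => // t /= st; rewrite /psi !word_distE invg1 mul1g geodesic_wlen//.
  have := wlenM hG (gamma 0%N)^-1%g (gamma t).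
  rewrite geodesic_wlen// wlenV// => le.
  by rewrite lerBlDr addrAC lerBrDr -!natrD ler_nat; lia.
rewrite -fz /psi !word_distE invg1 mul1g.
have := ler0n R (wlen ((gamma s)^-1 * z)%g).
rewrite /s !natrD; lra.
Qed.

Lemma busemann_pointP (f : {ptws G -> R}) : busemann_point d f <->
  exists2 gamma, geodesic_path d gamma & path_converges_to d gamma f.
Proof.
split=> [[_]//|[gamma geo cv]]; split; last by exists gamma.
exact: geodesic_limit_boundary cv.
Qed.

Lemma psi_natE z x (l m : nat) : wlen (x^-1 * z)%g = l -> wlen z = m ->
  psi R d z x = (l%:Z - m%:Z)%:~R.
Proof. by move=> <- <-; rewrite /psi !word_distE invg1 mul1g rmorphB. Qed.

(** A ray that ends by following [a] forever stays on the line through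
    [c^m b^n], and [wlen_far] computes all distances to it. *)
Lemma eventually_psi_eta gamma N :
  (forall t, (N <= t)%N -> gamma t.+1 = (gamma t * a)%g) ->
  forall i0 n m, co (gamma N) = (i0, n, m) ->
  eventually_psi gamma (eta_fun R a b 1 m n).
Proof.
move=> step i0 n m EN.
have Et s : co (gamma (N + s)%N) = (i0 + s%:Z, n, m).
  elim: s => [|s IH]; first by rewrite addn0 addr0.
  rewrite addnS step ?leq_addr// coM// IH co_a//.
  by apply: heisP => /=; lia.
move=> x; case Ex : (co x) => [[i j] k].
pose K := (j - n) * i - (k - m).
exists (N + `|((`|i0| + `|i| + `|K| + `|m| + 1)%R : int)|)%N => t Tt.
have [s ts st] : exists2 s, t = (N + s)%N & `|i0| + `|i| + `|K| + `|m| < s%:Z.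
  by exists (t - N)%N; lia.
have Exg : co (x^-1 * gamma t)%g = (i0 + s%:Z - i, n - j, K).
  rewrite coM// coV// Ex ts Et; rewrite /K; apply: heisP => /=; ring.
rewrite (psi_natE erefl erefl) /eta_fun.
rewrite [coords a b x]Ex; congr (_%:~R).
rewrite (wlen_far hG Exg); last by lia.
have Eg : co (gamma t) = (i0 + s%:Z, n, m) by rewrite ts.
rewrite (wlen_far hG Eg); last by lia.
rewrite !mul1r opprB !mulN1r (distrC n j) -/K; ring.
Qed.

(** Once both coordinates of [x^-1 * gamma t] are positive, a step [a]
    increases [i * j - k] and fixes [k], and a step [b] does the opposite;
    so eventually [0 <= k <= i * j]. *)
Lemma wlen_quadrant gamma N :
  (forall t, (N <= t)%N ->
     gamma t.+1 = (gamma t * a)%g \/ gamma t.+1 = (gamma t * b)%g) ->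
  (forall M, exists2 t, (M <= t)%N & gamma t.+1 = (gamma t * a)%g) ->
  (forall M, exists2 t, (M <= t)%N & gamma t.+1 = (gamma t * b)%g) ->
  forall x, exists T, forall t, (T <= t)%N ->
    (wlen (x^-1 * gamma t)%g)%:Z =
    (co (x^-1 * gamma t)%g).1.1 + (co (x^-1 * gamma t)%g).1.2.
Proof.
move=> step inf_a inf_b x.
pose u t : heis := co (x^-1 * gamma t)%g.
have ua t : gamma t.+1 = (gamma t * a)%g ->
    u t.+1 = ((u t).1.1 + 1, (u t).1.2, (u t).2).
  by move=> E; rewrite /u E mulgA coM// co_a//; apply: heisP => /=; ring.
have ub t : gamma t.+1 = (gamma t * b)%g ->
    u t.+1 = ((u t).1.1, (u t).1.2 + 1, (u t).2 + (u t).1.1).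
  by move=> E; rewrite /u E mulgA coM// co_b//; apply: heisP => /=; ring.
have [T1 I1] : exists T, forall t, (T <= t)%N -> 1 <= (u t).1.1.
  apply: (@diverges_of_increments _ N) => [t /step[/ua|/ub]->/=|M].
  - lia.
  - lia.
  - by have [t Mt /ua E] := inf_a M; exists t => //; rewrite E /=; lia.
have [T2 J1] : exists T, forall t, (T <= t)%N -> 1 <= (u t).1.2.
  apply: (@diverges_of_increments _ N) => [t /step[/ua|/ub]->/=|M].
  - lia.
  - lia.
  - by have [t Mt /ub E] := inf_b M; exists t => //; rewrite E /=; lia.
have [T3 K0] : exists T, forall t, (T <= t)%N -> 0 <= (u t).2.
  apply: (@diverges_of_increments _ (N + T1 + T2)) => [t Nt|M].
    have := I1 t; have := step t.
    by case=> [|/ua|/ub] => [|->|->] /=; lia.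
  have [t Mt /ub E] := inf_b (M + T1)%N; exists t; first by lia.
  by have := I1 t; rewrite E /=; lia.
have [T4 Q0] : exists T, forall t, (T <= t)%N ->
    0 <= (u t).1.1 * (u t).1.2 - (u t).2.
  apply: (@diverges_of_increments _ (N + T1 + T2)) => [t Nt|M].
    have := J1 t; have := step t.
    by case=> [|/ua|/ub] => [|->|->] /=; lia.
  have [t Mt /ua E] := inf_a (M + T2)%N; exists t; first by lia.
  by have := J1 t; rewrite E /=; lia.
exists (T1 + T2 + T3 + T4)%N => t Tt.
apply: (wlen_monotone hG (k := (u t).2)); rewrite -?/(u t).
- by rewrite -!surjective_pairing.
- by have := I1 t; lia.
- by have := J1 t; lia.
- by have := K0 t; have := Q0 t; lia.
Qed.

Lemma eventually_psi_xi gamma N :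
  (forall t, (N <= t)%N ->
     gamma t.+1 = (gamma t * a)%g \/ gamma t.+1 = (gamma t * b)%g) ->
  (forall M, exists2 t, (M <= t)%N & gamma t.+1 = (gamma t * a)%g) ->
  (forall M, exists2 t, (M <= t)%N & gamma t.+1 = (gamma t * b)%g) ->
  eventually_psi gamma (xi_fun R a b 1 1).
Proof.
move=> step inf_a inf_b x.
have [T1 lenx] := wlen_quadrant step inf_a inf_b x.
have [T2 len1] := wlen_quadrant step inf_a inf_b 1%g.
exists (T1 + T2)%N => t Tt.
have := lenx t; have := len1 t; rewrite invg1 mul1g => {}len1 {}lenx.
rewrite (psi_natE erefl erefl) /xi_fun -/(co x).
rewrite len1 ?lenx; [|lia..].
rewrite coM// coV//; case: (co x) => [[i j] k] /=.
congr (_%:~R); ring.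
Qed.

End Limits.

(** * Turns of a geodesic *)

(** A letter is a pair (vertical?, inverted?). *)
Definition letter : Type := (bool * bool)%type.

Definition gen (G : groupType) (a b : G) (l : letter) : G :=
  let x := if l.1 then b else a in if l.2 then x^-1%g else x.

(** The letter after a counterclockwise turn, so that [rot (rot l)] is the
    inverse of [l]. *)
Definition rot (l : letter) : letter := (~~ l.1, if l.1 then ~~ l.2 else l.2).

Definition infinitely_often (P : nat -> Prop) : Prop :=
  forall M, exists2 t, (M <= t)%N & P t.

Definition displacement (l : letter) (n : int) : heis :=
  let m := if l.2 then - n else n in if l.1 then (0, m, 0) else (m, 0, 0).

Section Turns.
Variables (G : groupType) (a b : G).
Hypothesis hG : is_heisenberg_group a b.

Local Notation d := (word_dist (generators a b)).
Local Notation co := (co a b).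
Local Notation wlen := (wlen a b).
Local Notation gen := (gen a b).

Lemma co_inj : injective co. Proof. exact: can_inj (coK hG). Qed.

Lemma co_gen l : co (gen l) = displacement l 1.
Proof. by case: l => [[] []]; rewrite /gen /= ?coV// ?co_a ?co_b. Qed.

Lemma gen_generators l : generators a b (gen l).
Proof. by case: l => [[] []]; rewrite /generators /gen /=; tauto. Qed.

(* [c ^ k], locked to remain a single factor under [coM]. *)
Let z (k : int) : G := locked (normal_form a b 0 0 k).

Lemma co_z k : co (z k) = (0, 0, k).
Proof. by rewrite /z -lock co_normal_form. Qed.

Lemma conj_center g h : exists k, (g * h * g^-1)%g = (h * z k)%g.
Proof.
exists ((co g).1.1 * (co h).1.2 - (co h).1.1 * (co g).1.2).
by apply: co_inj; rewrite !coM// coV// co_z; apply: heisP => /=; ring.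
Qed.

Section Path.
Variable gamma : nat -> G.
Hypothesis geo : geodesic_path d gamma.

Lemma geodesic_letters :
  exists s : nat -> letter, forall t, gamma t.+1 = (gamma t * gen (s t))%g.
Proof.
have step t : exists l, gamma t.+1 = (gamma t * gen l)%g.
  have /(wlen_eq1 hG) : wlen ((gamma t)^-1 * gamma t.+1)%g = 1%N.
    by rewrite geodesic_wlen//; lia.
  move=> [[[]|]|] E; [exists (false, false) | exists (true, false)
    | exists (false, true) | exists (true, true)];
  by rewrite /gen /= -E mulVKg.
by have [s sP] := choice step; exists s.
Qed.

(** Some stretch of the geodesic that starts at time [N] can be replaced by a
    word that is no longer and that has the same endpoint but [k] more area:
    the area can be changed by [k] free of charge. *)
Definition room (N : nat) (k : int) : Prop :=
  exists2 t, (N <= t)%N &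
    (wlen ((gamma N)^-1 * gamma t * z k)%g <= t - N)%N.

Lemma room0 N : room N 0.
Proof.
exists N => //; rewrite mulVg mul1g subnn.
have -> : z 0 = 1%g by apply: co_inj; rewrite co_z co1.
by rewrite wlen1.
Qed.

(** Changes of area in successive stretches add up. *)
Lemma room_cat N k : room N k ->
  exists2 t, (N <= t)%N & forall k', room t k' -> room N (k + k').
Proof.
move=> [t Nt le]; exists t => // k' [t' tt' le'].
exists t'; first exact: leq_trans tt'.
have -> : ((gamma N)^-1 * gamma t' * z (k + k') =
  ((gamma N)^-1 * gamma t * z k) * ((gamma t)^-1 * gamma t' * z k'))%g.
  apply: co_inj; rewrite !coM// !coV// !co_z; apply: heisP => /=; ring.
apply: leq_trans (wlenM hG _ _) _.
by apply: leq_trans (leq_add le le') _; lia.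
Qed.

Lemma room_weaken N M k : (N <= M)%N -> room M k -> room N k.
Proof.
move=> NM [t Mt le]; exists t; first exact: leq_trans Mt.
have -> : ((gamma N)^-1 * gamma t * z k =
  ((gamma N)^-1 * gamma M) * ((gamma M)^-1 * gamma t * z k))%g.
  by rewrite !mulgA mulgK.
apply: leq_trans (wlenM hG _ _) _.
by rewrite geodesic_wlen//; apply: leq_trans (leq_add (leqnn _) le) _; lia.
Qed.

(** Gains of uncontrolled size overshoot the target, and unit losses further
    along correct the excess. *)
Lemma room_unbounded :
  (forall N, exists2 k, 0 < k & room N k) -> (forall N, room N (-1)) ->
  forall N k, room N k.
Proof.
move=> up down.
have large (n : nat) : forall N, exists2 k, n%:Z <= k & room N k.
  elim: n => [|n IH] N; first by exists 0 => //; apply: room0.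
  have [k k0 /room_cat[t Nt cat]] := up N.
  by have [k' nk' /cat r] := IH t; exists (k + k') => //; lia.
have small (n : nat) : forall N, room N (- n%:Z).
  elim: n => [|n IH] N; first exact: room0.
  have [t Nt cat] := room_cat (down N).
  by have := cat _ (IH t); congr room; lia.
move=> N k; have [k' kk' /room_cat[t Nt cat]] := large `|k|%N N.
have := cat _ (small `|(k' - k)%R|%N t).
by congr room; lia.
Qed.

Section Letters.
Variable s : nat -> letter.
Hypothesis step : forall t, gamma t.+1 = (gamma t * gen (s t))%g.

(** Deleting a letter and a later inverse letter changes the area by some
    [k]; when there is room to restore it, the geodesic could be shortened
    by two. *)
Lemma room_no_inverse : (forall N k, room N k) ->
  forall t t', (t < t')%N -> s t' <> rot (rot (s t)).
Proof.
move=> rm t t' tt' E.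
have gV : gen (s t') = (gen (s t))^-1%g.
  by rewrite E /gen; case: (s t) => [[] []] /=; rewrite ?invgK.
have [k kE] := conj_center (gen (s t)) ((gamma t.+1)^-1 * gamma t')%g.
have [t'' t't'' le] := rm t'.+1 k.
have E2 : ((gamma t)^-1 * gamma t'' =
  (gen (s t) * ((gamma t.+1)^-1 * gamma t') * (gen (s t))^-1) *
  ((gamma t'.+1)^-1 * gamma t''))%g.
  by rewrite -gV !step !invgM !mulgA !(mulgK, mulgVK) mulgV mul1g.
have E3 : ((gamma t)^-1 * gamma t'' = ((gamma t.+1)^-1 * gamma t') *
  ((gamma t'.+1)^-1 * gamma t'' * z k))%g.
  rewrite E2 kE.
  by apply: co_inj; rewrite !coM// !coV// !co_z; apply: heisP => /=; ring.
have : (wlen ((gamma t)^-1 * gamma t'')%g <= (t' - t.+1) + (t'' - t'.+1))%N.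
  rewrite E3; apply: leq_trans (wlenM hG _ _) _.
  by rewrite geodesic_wlen// leq_add.
by rewrite geodesic_wlen//; lia.
Qed.

Lemma letters_cases t :
  [\/ s t.+1 = s t, s t.+1 = rot (s t) | s t = rot (s t.+1)].
Proof.
have : s t.+1 <> rot (rot (s t)).
  move=> E; have : wlen ((gamma t)^-1 * gamma t.+2)%g = 2.
    by rewrite geodesic_wlen//; lia.
  have -> : gamma t.+2 = gamma t.
    rewrite !step E /gen; case: (s t) => [[] []] /=;
    by rewrite ?invgK ?mulgK ?mulgVK.
  by rewrite mulVg wlen1.
case: (s t) (s t.+1) => [[] []] [[] []] //= _;
  by [apply: Or31 | apply: Or32 | apply: Or33].
Qed.

(** Exchanging two consecutive letters keeps the length and the endpoint and
    trades one area for the other. *)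
Lemma room_turn t l l' : s t = l -> s t.+1 = l' ->
  room t ((co (gen l' * gen l)%g).2 - (co (gen l * gen l')%g).2).
Proof.
move=> sl sl'; exists t.+2; first lia.
rewrite -addn2 addKn !addnS addn0.
have -> : ((gamma t)^-1 * gamma t.+2 *
   z ((co (gen l' * gen l)).2 - (co (gen l * gen l')).2) =
   gen l' * gen l)%g.
  rewrite !step sl sl' !mulgA mulVg mul1g; apply: co_inj.
  by rewrite !coM// co_z !co_gen; apply: heisP => /=; ring.
apply: leq_trans (wlenM hG _ _) _.
have le l'' := wlen_gen hG (gen_generators l'').
exact: leq_add (le _) (le _).
Qed.

Lemma room_ccw t : s t.+1 = rot (s t) -> room t (-1).
Proof.
move=> E; have := room_turn erefl E; congr room.
by rewrite !coM// !co_gen; case: (s t) => [[] []] /=; lia.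
Qed.

Lemma room_cw t : s t = rot (s t.+1) -> room t 1.
Proof.
move=> E; have := room_turn E erefl; congr room.
by rewrite !coM// !co_gen; case: (s t.+1) => [[] []] /=; lia.
Qed.

(** The exchange at a turn of either kind is available arbitrarily late. *)
Lemma two_way_no_inverse :
  infinitely_often (fun t => s t.+1 = rot (s t)) ->
  infinitely_often (fun t => s t = rot (s t.+1)) ->
  forall t t', (t < t')%N -> s t' <> rot (rot (s t)).
Proof.
move=> ccw cw; apply/room_no_inverse/room_unbounded => N.
  by have [t Nt /room_cw r] := cw N; exists 1 => //; apply: room_weaken r.
by have [t Nt /room_ccw r] := ccw N; apply: room_weaken r.
Qed.

Section Spiral.
Variable N0 : nat.
Hypothesis ccw_only :
  forall t, (N0 <= t)%N -> s t.+1 = s t \/ s t.+1 = rot (s t).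
Hypothesis ccw_often : infinitely_often (fun t => s t.+1 = rot (s t)).

(** Turns recur, so every side of the spiral ends and the next one starts. *)
Lemma spiral_side t : (N0 <= t)%N -> exists n : nat,
  [/\ (0 < n)%N, co (gamma (t + n)%N) =
      (co (gamma t) * displacement (s t) n%:Z)%g & s (t + n)%N = rot (s t)].
Proof.
have [u + uE] := ccw_often t.
move=> tu; have [m mE] : exists m, u = (t + m)%N by exists (u - t)%N; lia.
elim: m t mE {tu} => [|m IH] t mE Nt.
  exists 1%N; split=> //; rewrite addn1.
    by rewrite step coM// co_gen.
  by rewrite -[t]addn0 -mE.
have [E|E] := ccw_only Nt.
  have [|n [n0 nE sE]] := IH t.+1 _ (leqW Nt); first by rewrite mE addSnnS.
  exists n.+1; rewrite -addSnnS; split=> //; last by rewrite sE E.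
  rewrite nE step coM// co_gen E -mulgA; congr (_ * _)%g.
  by case: (s t) => [[] []]; apply: heisP => /=; lia.
by exists 1%N; split=> //; rewrite addn1// step coM// co_gen.
Qed.

Lemma reach_spiral (p q r t v w : nat) :
  reach a b (p + q + r + t + v + w) (p%:Z - r%:Z + v%:Z) (q%:Z - t%:Z + w%:Z)
    (p%:Z * q%:Z - (p%:Z - r%:Z) * t%:Z + (p%:Z - r%:Z + v%:Z) * w%:Z).
Proof.
have e1 : (1 : int) = 1 \/ (1 : int) = -1 by left.
have e2 : (-1 : int) = 1 \/ (-1 : int) = -1 by right.
have := reach_bX hG w e1 (reach_aX hG v e1 (reach_bX hG t e2 (reach_aX hG r e2
  (reach_bX hG q e1 (reach_aX hG p e1 (reach0 hG)))))).
by rewrite add0n; congr reach; ring.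
Qed.

(** Over one and a half laps [a^n1 b^n2 a^-n3 b^-n4 a^n5 b] of the spiral,
    moving an [a] between the first and the fifth side, or a [b] between the
    second and the sixth, changes the area by the difference of two parallel
    sides. If these differences vanish, moving both letters gains one. *)
Lemma spiral_gain N : exists2 k, 0 < k & room N k.
Proof.
have [t0 [Nt0 N0t0 s0]] :
    exists t0, [/\ (N <= t0)%N, (N0 <= t0)%N & s t0 = (false, false)].
  pose M := (N + N0)%N; have NM : (N0 <= M)%N by rewrite leq_addl.
  have [n1 [_ _ s1]] := spiral_side NM.
  have NM1 := leq_trans NM (leq_addr n1 M).
  have [n2 [_ _ s2]] := spiral_side NM1.
  have NM2 := leq_trans NM1 (leq_addr n2 _).
  have [n3 [_ _ s3]] := spiral_side NM2.
  rewrite s2 s1 in s3; rewrite s1 in s2.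
  case E : (s M) s1 s2 s3 => [[] []] /= s1 s2 s3.
  (* The side that runs along [a] is at most three turns away. *)
  - by exists (M + n1)%N; split=> //; rewrite /M; lia.
  - by exists (M + n1 + n2 + n3)%N; split=> //; rewrite /M; lia.
  - by exists (M + n1 + n2)%N; split=> //; rewrite /M; lia.
  - by exists M; split=> //; rewrite /M; lia.
have [n1 [n1_gt0 g1 s1]] := spiral_side N0t0; rewrite s0 in g1 s1.
have N1 := leq_trans N0t0 (leq_addr n1 _).
have [n2 [n2_gt0 g2 s2]] := spiral_side N1; rewrite s1 in g2 s2.
have N2 := leq_trans N1 (leq_addr n2 _).
have [n3 [n3_gt0 g3 s3]] := spiral_side N2; rewrite s2 in g3 s3.
have N3 := leq_trans N2 (leq_addr n3 _).
have [n4 [n4_gt0 g4 s4]] := spiral_side N3; rewrite s3 in g4 s4.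
have N4 := leq_trans N3 (leq_addr n4 _).
have [n5 [n5_gt0 g5 s5]] := spiral_side N4; rewrite s4 in g5 s5.
set t5 := (_ + n5)%N in g5 s5.
have E : co ((gamma t0)^-1 * gamma t5.+1)%g =
    (n1%:Z - n3%:Z + n5%:Z, n2%:Z - n4%:Z + 1,
     n1%:Z * n2%:Z - (n1%:Z - n3%:Z) * n4%:Z + (n1%:Z - n3%:Z + n5%:Z)).
  rewrite step s5 !coM// coV// co_gen g5 g4 g3 g2 g1.
  by apply: heisP => /=; ring.
have gain n i j k k' : n = (t5.+1 - t0)%N -> 0 < k' ->
    i = n1%:Z - n3%:Z + n5%:Z -> j = n2%:Z - n4%:Z + 1 ->
    k = n1%:Z * n2%:Z - (n1%:Z - n3%:Z) * n4%:Z +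
        (n1%:Z - n3%:Z + n5%:Z) + k' ->
    reach a b n i j k -> exists2 k, 0 < k & room N k.
  move=> -> k'0 iE jE kE r; exists k' => //.
  apply: (room_weaken Nt0); exists t5.+1; first by rewrite /t5; lia.
  have gE : co ((gamma t0)^-1 * gamma t5.+1 * z k')%g = (i, j, k).
    by rewrite coM// E co_z iE jE kE; apply: heisP => /=; ring.
  exact/(reachP hG _ gE).
have t5E : (t5.+1 - t0)%N = (n1 + n2 + n3 + n4 + n5 + 1)%N.
  by rewrite /t5; lia.
have [n24|n42|e24] := ltngtP n2 n4.
- apply: (gain _ _ _ _ (n4%:Z - n2%:Z) _ _ _ _ _
    (reach_spiral n1.-1 n2 n3 n4 n5.+1 1)); nia.
- apply: (gain _ _ _ _ (n2%:Z - n4%:Z) _ _ _ _ _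
    (reach_spiral n1.+1 n2 n3 n4 n5.-1 1)); nia.
have [n35|n53|e35] := ltngtP n3 n5.
- apply: (gain _ _ _ _ (n5%:Z - n3%:Z) _ _ _ _ _
    (reach_spiral n1 n2.-1 n3 n4 n5 2)); nia.
- apply: (gain _ _ _ _ (n3%:Z - n5%:Z) _ _ _ _ _
    (reach_spiral n1 n2.+1 n3 n4 n5 0)); nia.
- apply: (gain _ _ _ _ 1 _ _ _ _ _
    (reach_spiral n1.+1 n2.+1 n3 n4 n5.-1 0)); nia.
Qed.

(** The side after next of a spiral runs along the inverse letter. *)
Lemma no_spiral : False.
Proof.
have rm : forall N k, room N k.
  apply: room_unbounded => N; first exact: spiral_gain.
  by have [t Nt /room_ccw r] := ccw_often N; apply: room_weaken r.
have [n1 [n1_gt0 _ s1]] := spiral_side (leqnn N0).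
have [n2 [n2_gt0 _ s2]] := spiral_side (leq_addr n1 N0).
by apply: (room_no_inverse rm) (etrans s2 (congr1 rot s1)); lia.
Qed.

End Spiral.
End Letters.
End Path.
End Turns.

(** * Symmetries *)

Lemma heisenberg_relations_swap (G : groupType) (a b : G) :
  heisenberg_relations a b -> heisenberg_relations b a.
Proof.
move=> [/eqP/commgP ca /eqP/commgP cb].
rewrite /heisenberg_relations -(invgR a b).
by split; apply/eqP/commgP/commute_sym/commuteV/commute_sym.
Qed.

Lemma heisenberg_relations_invl (G : groupType) (a b : G) :
  heisenberg_relations a b -> heisenberg_relations a^-1%g b.
Proof.
move=> [/eqP/commgP ca /eqP/commgP cb].
have -> : heisenberg_relations a^-1%g b <->
    [~ [~ a, b]^-1, a^-1]%g = 1%g /\ [~ [~ a, b]^-1, b]%g = 1%g.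
  rewrite /heisenberg_relations.
  have -> : [~ a^-1, b]%g = [~ a, b]^-1%g.
    have -> : [~ a^-1, b]%g = (a * [~ a, b]^-1 * a^-1)%g.
      by rewrite invgR /commg /conjg !mulgA invgK mulgK.
    by rewrite (commuteV (commute_sym ca)) mulgK.
  by [].
split; apply/eqP/commgP/commute_sym/commuteV/commute_sym => //.
exact: commuteV.
Qed.

Lemma is_heisenberg_swap (G : groupType) (a b : G) :
  is_heisenberg_group a b -> is_heisenberg_group b a.
Proof.
move=> [rel univ]; split; first exact: heisenberg_relations_swap.
move=> K x y /heisenberg_relations_swap /univ[f [fa fb] uniq].
by exists f => // g gb ga; apply: uniq.
Qed.

Lemma is_heisenberg_invl (G : groupType) (a b : G) :
  is_heisenberg_group a b -> is_heisenberg_group a^-1%g b.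
Proof.
move=> [rel univ]; split; first exact: heisenberg_relations_invl.
move=> K x y /heisenberg_relations_invl /univ[f [fa fb] uniq].
exists f; first by rewrite morphV ?fa ?invgK//; exact: gmulfM.
move=> g ga gb; apply: uniq => //.
by rewrite -[a]invgK morphV ?ga//; exact: gmulfM.
Qed.

Section Symmetries.
Variables (R : realType) (G : groupType) (a b : G).
Hypothesis hG : is_heisenberg_group a b.

(** In the swapped pair the commutator is [c^-1], and
    [b^j a^i = a^i b^j c^(- i j)]. *)
Lemma co_swap g : co b a g =
  ((co a b g).1.2, (co a b g).1.1,
   (co a b g).1.1 * (co a b g).1.2 - (co a b g).2).
Proof.
have hG' := is_heisenberg_swap hG.
pose h x : heis := ((co a b x).1.2, (co a b x).1.1,
  (co a b x).1.1 * (co a b x).1.2 - (co a b x).2).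
apply: (heisenberg_morph_ext (g := h) hG).
- by move=> x y; rewrite coM.
- by move=> x y; rewrite /h coM//; apply: heisP => /=; ring.
- by rewrite /h co_a// co_b//; apply: heisP => /=; ring.
- by rewrite /h co_b// co_a//; apply: heisP => /=; ring.
Qed.

Lemma co_invl g : co a^-1%g b g =
  (- (co a b g).1.1, (co a b g).1.2, - (co a b g).2).
Proof.
have hG' := is_heisenberg_invl hG.
pose h x : heis := (- (co a b x).1.1, (co a b x).1.2, - (co a b x).2).
apply: (heisenberg_morph_ext (g := h) hG).
- by move=> x y; rewrite coM.
- by move=> x y; rewrite /h coM//; apply: heisP => /=; ring.
- have := coV hG' a^-1%g; rewrite invgK co_a// /h co_a// => ->.

- by rewrite /h !co_b//; apply: heisP => /=; ring.
Qed.

Lemma J_opp u v : J (- u) (- v) = J u v.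
Proof. by rewrite /J oppr_eq0 mulrNN. Qed.

Lemma eta_invl eps m n :
  eta_fun R a^-1%g b eps m n = eta_fun R a b (- eps) (- m) n.
Proof.
apply/funext => g; rewrite /eta_fun -!/(co _ _ g) co_invl.
case: (co a b g) => [[i j] k] /=; congr (_%:~R).
have -> : J (- eps * (j - n)) ((j - n) * i - (k - - m)) =
    J (eps * (j - n)) ((j - n) * - i - (- k - m)).
  by rewrite -J_opp; congr J; ring.
have -> : J (- - eps * n) (- m) = J (- eps * n) m.
  by rewrite -J_opp; congr J; ring.
ring.
Qed.

Lemma eta_swap eps m n :
  eta_fun R b a eps m n = zeta_fun R a b eps (- m) n.
Proof.
apply/funext => g; rewrite /eta_fun /zeta_fun -!/(co _ _ g) co_swap.
case: (co a b g) => [[i j] k] /=; congr (_%:~R).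
have -> : J (- eps * (i - n)) (j * n - (k - - m)) =
    J (eps * (i - n)) ((i - n) * j - (i * j - k - m)).
  by rewrite -J_opp; congr J; ring.
have -> // : J (eps * n) (- m) = J (- eps * n) m.
by rewrite -J_opp; congr J; ring.
Qed.

Lemma xi_invl e e' : xi_fun R a^-1%g b e e' = xi_fun R a b (- e) e'.
Proof.
apply/funext => g; rewrite /xi_fun -!/(co _ _ g) co_invl.
by case: (co a b g) => [[i j] k] /=; congr (_%:~R); ring.
Qed.

Lemma xi_swap e e' : xi_fun R b a e e' = xi_fun R a b e' e.
Proof.
apply/funext => g; rewrite /xi_fun -!/(co _ _ g) co_swap.
by case: (co a b g) => [[i j] k] /=; congr (_%:~R); ring.
Qed.

End Symmetries.

Lemma is_signN e : is_sign e -> is_sign (- e).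
Proof. by case=> ->; [right; rewrite opprK | left]. Qed.

Definition in_families (R : realType) (G : groupType) (a b : G)
    (f : {ptws G -> R}) : Prop :=
  [\/ exists eps m n : int, is_sign eps /\ f = eta_fun R a b eps m n,
      exists eps m l : int, is_sign eps /\ f = zeta_fun R a b eps m l |
      exists eps_a eps_b : int,
        [/\ is_sign eps_a, is_sign eps_b & f = xi_fun R a b eps_a eps_b]].

Section FamilySymmetries.
Variables (R : realType) (G : groupType) (a b : G).
Hypothesis hG : is_heisenberg_group a b.

Lemma zeta_swap eps m l :
  zeta_fun R b a eps m l = eta_fun R a b eps (- m) l.
Proof. by rewrite (eta_swap R (is_heisenberg_swap hG)) opprK. Qed.

Lemma zeta_invl eps m l :
  zeta_fun R a^-1%g b eps m l = zeta_fun R a b eps (- m) (- l).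
Proof.
apply/funext => g; rewrite /zeta_fun -!/(co _ _ g) (co_invl hG).
case: (co a b g) => [[i j] k] /=; congr (_%:~R).
have -> : J (- eps * (i - - l)) (j * - l - (k - - m)) =
    J (- eps * (- i - l)) (j * l - (- k - m)).
  by rewrite -J_opp; congr J; ring.
have -> : J (eps * - l) (- m) = J (eps * l) m.
  by rewrite -J_opp; congr J; ring.
by rewrite -opprD normrN opprK normrN.
Qed.

Lemma in_families_swap (f : {ptws G -> R}) :
  in_families b a f -> in_families a b f.
Proof.
move=> [[e [m [n [se ->]]]]|[e [m [n [se ->]]]]|[e [e' [se se' ->]]]].
- by apply: Or32; exists e, (- m), n; rewrite eta_swap.
- by apply: Or31; exists e, (- m), n; rewrite zeta_swap.
- by apply: Or33; exists e', e; rewrite xi_swap.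
Qed.

Lemma in_families_invl (f : {ptws G -> R}) :
  in_families a^-1%g b f -> in_families a b f.
Proof.
move=> [[e [m [n [se ->]]]]|[e [m [n [se ->]]]]|[e [e' [se se' ->]]]].
- by apply: Or31; exists (- e), (- m), n; rewrite eta_invl//;
    split=> //; apply: is_signN.
- by apply: Or32; exists e, (- m), (- n); rewrite zeta_invl.
- by apply: Or33; exists (- e), e'; rewrite xi_invl//;
    split=> //; apply: is_signN.
Qed.

End FamilySymmetries.

(** * Classification of the limits of geodesics *)

Definition limit_in_families (R : realType) (G : groupType) (a b : G)
    (gamma : nat -> G) : Prop :=
  exists2 f : {ptws G -> R}, eventually_psi a b gamma f & in_families a b f.

Section LimitSymmetries.
Variables (R : realType) (G : groupType) (a b : G) (gamma : nat -> G).
Hypothesis hG : is_heisenberg_group a b.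

Lemma limit_in_families_swap :
  limit_in_families R b a gamma -> limit_in_families R a b gamma.
Proof.
move=> [f ev ff]; exists f; last exact: in_families_swap.
by rewrite /eventually_psi -swap_generators.
Qed.

Lemma limit_in_families_invl :
  limit_in_families R a^-1%g b gamma -> limit_in_families R a b gamma.
Proof.
move=> [f ev ff]; exists f; last exact: in_families_invl.
by rewrite /eventually_psi -invl_generators.
Qed.

End LimitSymmetries.

Section LimitOfGeodesics.
Variables (R : realType) (G : groupType).
Implicit Types (a b : G) (gamma : nat -> G).

Lemma limit_straight a b gamma N : is_heisenberg_group a b ->
  (forall t, (N <= t)%N -> gamma t.+1 = (gamma t * a)%g) ->
  limit_in_families R a b gamma.
Proof.
move=> hG step; case E : (co a b (gamma N)) => [[i n] m].
exists (eta_fun R a b 1 m n); first exact: (eventually_psi_eta R hG step E).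
by apply: Or31; exists 1, m, n; split=> //; right.
Qed.

Lemma limit_quadrant a b gamma N : is_heisenberg_group a b ->
  (forall t, (N <= t)%N ->
     gamma t.+1 = (gamma t * a)%g \/ gamma t.+1 = (gamma t * b)%g) ->
  infinitely_often (fun t => gamma t.+1 = (gamma t * a)%g) ->
  infinitely_often (fun t => gamma t.+1 = (gamma t * b)%g) ->
  limit_in_families R a b gamma.
Proof.
move=> hG step inf_a inf_b; exists (xi_fun R a b 1 1).
  exact: (eventually_psi_xi R hG step inf_a inf_b).
by apply: Or33; exists 1, 1; split=> //; right.
Qed.

(** Every letter is the first generator of one of the pairs obtained from
    [(a, b)] by exchanges and inversions of the first generator. *)
Lemma limit_letter a b gamma N l : is_heisenberg_group a b ->
  (forall t, (N <= t)%N -> gamma t.+1 = (gamma t * gen a b l)%g) ->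
  limit_in_families R a b gamma.
Proof.
move=> hG; have hG' := is_heisenberg_swap hG.
case: l => [[] []] step.
- apply/(limit_in_families_swap hG)/(limit_in_families_invl hG').
  exact: (limit_straight (is_heisenberg_invl hG') step).
- exact/(limit_in_families_swap hG)/(limit_straight hG' step).
- apply: (limit_in_families_invl hG).
  exact: (limit_straight (is_heisenberg_invl hG) step).
- exact: (limit_straight hG step).
Qed.

Lemma limit_two_letters a b gamma N e e' : is_heisenberg_group a b ->
  let x := gen a b (false, e) in let y := gen a b (true, e') in
  (forall t, (N <= t)%N ->
     gamma t.+1 = (gamma t * x)%g \/ gamma t.+1 = (gamma t * y)%g) ->
  infinitely_often (fun t => gamma t.+1 = (gamma t * x)%g) ->
  infinitely_often (fun t => gamma t.+1 = (gamma t * y)%g) ->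
  limit_in_families R a b gamma.
Proof.
move=> hG x y step inf_x inf_y.
have invl c d : is_heisenberg_group c d ->
    is_heisenberg_group (if e then c^-1 else c)%g d /\
    (limit_in_families R (if e then c^-1 else c)%g d gamma ->
     limit_in_families R c d gamma).
  move=> hcd; case: e {x step inf_x} => //; split.
    exact: is_heisenberg_invl.
  exact: limit_in_families_invl.
have invr c d : is_heisenberg_group c d ->
    is_heisenberg_group c (if e' then d^-1 else d)%g /\
    (limit_in_families R c (if e' then d^-1 else d)%g gamma ->
     limit_in_families R c d gamma).
  move=> hcd; have hdc := is_heisenberg_swap hcd.
  case: e' {y step inf_y} => //; split.
    exact/is_heisenberg_swap/is_heisenberg_invl.
  have hdc' := is_heisenberg_invl hdc.
  move=> lim; apply/(limit_in_families_swap hcd)/(limit_in_families_invl hdc).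
  exact: limit_in_families_swap lim.
have [h1 lim1] := invl _ _ hG; have [h2 lim2] := invr _ _ h1.
exact/lim1/lim2/(limit_quadrant h2 step inf_x inf_y).
Qed.

Lemma not_infinitely_often (P : nat -> Prop) : ~ infinitely_often P ->
  exists N, forall t, (N <= t)%N -> ~ P t.
Proof.
move=> nP; apply: contrapT => nN; apply: nP => M; apply: contrapT => nM.
by apply: nN; exists M => t Mt Pt; apply: nM; exists t.
Qed.

Lemma geodesic_limit a b gamma : is_heisenberg_group a b ->
  geodesic_path (word_dist (generators a b)) gamma ->
  limit_in_families R a b gamma.
Proof.
move=> hG geo; have [s step] := geodesic_letters hG geo.
have cases := letters_cases hG geo step.
have [ccw|/not_infinitely_often[N1 nccw]] :=
    pselect (infinitely_often (fun t => s t.+1 = rot (s t)));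
  have [cw|/not_infinitely_often[N2 ncw]] :=
    pselect (infinitely_often (fun t => s t = rot (s t.+1))).
- have noinv := two_way_no_inverse hG geo step ccw cw.
  have [N _ sN] := ccw 0%N.
  (* After one turn only the two letters of that turn remain available. *)
  have two t : (N.+1 < t)%N -> s t = s N \/ s t = s N.+1.
    move=> Nt; have := noinv N t (ltnW Nt); have := noinv N.+1 t Nt.
    rewrite sN; case: (s N) (s t) => [[] []] [[] []] //=; tauto.
  have often : infinitely_often (fun t => s t = s N) /\
               infinitely_often (fun t => s t = s N.+1).
    have both M : exists t1 t2, [/\ (M <= t1)%N, (M <= t2)%N,
        s t1 = s N & s t2 = s N.+1].
      have [t Mt st] := ccw (M + N.+2)%N.
      have t_two := two t ltac:(lia); have t1_two := two t.+1 ltac:(lia).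
      have : s t.+1 <> s t by rewrite st; case: (s t) => [[] []].
      case: t_two => E; case: t1_two => E1; rewrite E E1 => neq //.
        by exists t, t.+1; split=> //; lia.
      by exists t.+1, t; split=> //; lia.
    by split=> M; have [t1 [t2 [? ? ? ?]]] := both M; [exists t1|exists t2].
  case: often => oftN oftN1.
  have lift l : infinitely_often (fun t => s t = l) ->
      infinitely_often (fun t => gamma t.+1 = (gamma t * gen a b l)%g).
    by move=> oft M; have [t Mt st] := oft M; exists t => //; rewrite step st.
  case EN : (s N) => [v e]; rewrite sN EN /rot /= in two oftN oftN1.
  case: v {EN sN} two oftN oftN1 => /= two oftN oftN1.
  + apply: (limit_two_letters (N := N.+2) hG _ (lift _ oftN1) (lift _ oftN)).
    by move=> t /two[E|E]; rewrite step E; tauto.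
  + apply: (limit_two_letters (N := N.+2) hG _ (lift _ oftN) (lift _ oftN1)).
    by move=> t /two[E|E]; rewrite step E; tauto.
- exfalso; apply: (no_spiral hG geo step (N0 := N2)) ccw => t N2t.
  by case: (cases t) => [|| /(ncw _ N2t)//]; tauto.
- (* Exchanging the two generators turns a clockwise spiral into a
     counterclockwise one. *)
  pose flip (l : letter) : letter := (~~ l.1, l.2).
  have geo' : geodesic_path (word_dist (generators b a)) gamma.
    by rewrite swap_generators.
  have step' t : gamma t.+1 = (gamma t * gen b a (flip (s t)))%g.
    by rewrite step /gen /flip /=; case: (s t).1.
  have flip_rot t : s t = rot (s t.+1) <-> flip (s t.+1) = rot (flip (s t)).
    by case: (s t) (s t.+1) => [[] []] [[] []].
  exfalso; apply: (no_spiral (is_heisenberg_swap hG) geo' step' (N0 := N1)).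
    move=> t N1t; case: (cases t) => [->|/(nccw _ N1t)//|/flip_rot]; tauto.
  by move=> M; have [t Mt /flip_rot E] := cw M; exists t.
- (* Without turns the letter is eventually constant. *)
  pose N := (N1 + N2)%N.
  have const t : s (N + t)%N = s N.
    elim: t => [|t IH]; first by rewrite addn0.
    rewrite addnS -IH; case: (cases (N + t)%N) => [//|/nccw|/ncw] []; lia.
  apply: (limit_letter (N := N) (l := s N) hG) => t Nt.
  by rewrite step -(const (t - N)%N) subnKC.
Qed.

End LimitOfGeodesics.

(** * The three families are Busemann points *)

Section Realization.
Variables (R : realType) (G : groupType) (a b : G).
Hypothesis hG : is_heisenberg_group a b.

Lemma geodesic_path_le gamma :
  (forall s t, (s <= t)%N ->
     wlen a b ((gamma s)^-1 * gamma t)%g = (t - s)%N) ->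
  geodesic_path (word_dist (generators a b)) gamma.
Proof.
move=> geo s t; rewrite word_distE.
have [st|/ltnW ts] := leqP s t; first by rewrite geo//; lia.
rewrite -(wlenV hG) invgM invgK geo//; lia.
Qed.

Lemma busemann_eta m n :
  busemann_point (word_dist (generators a b)) (eta_fun R a b 1 m n).
Proof.
apply/(busemann_pointP hG).
pose gamma (t : nat) := normal_form a b t%:Z n m.
have cog t : co a b (gamma t) = (t%:Z, n, m) by exact: co_normal_form.
exists gamma.
  apply: geodesic_path_le => s t st.
  have E : co a b ((gamma s)^-1 * gamma t)%g = (t%:Z - s%:Z, 0, 0).
    by rewrite coM// coV// !cog; apply: heisP => /=; ring.
  have := wlen_monotone hG E; rewrite mulr0; lia.
have step t : gamma t.+1 = (gamma t * a)%g.
  apply: (co_inj hG); rewrite coM// co_a// !cog.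
  by apply: heisP => /=; lia.
apply: eventually_psi_cvg.
exact: (eventually_psi_eta R hG (N := 0%N) (fun t _ => step t) (cog 0%N)).
Qed.

(** The staircase [a b a b ...] is a geodesic because its words are as long as
    their image in the abelianization. *)
Lemma busemann_xi :
  busemann_point (word_dist (generators a b)) (xi_fun R a b 1 1).
Proof.
apply/(busemann_pointP hG).
pose fix gamma (t : nat) : G :=
  if t is t'.+1 then (gamma t' * if odd t' then b else a)%g else 1%g.
have step t : gamma t.+1 = (gamma t * if odd t then b else a)%g by [].
exists gamma.
  apply: geodesic_path_le => s t st.
  have up r : (wlen a b ((gamma s)^-1 * gamma (s + r)%N)%g <= r)%N.
    elim: r => [|r IH]; first by rewrite addn0 mulVg wlen1.
    rewrite addnS step mulgA; apply: leq_trans (wlenM hG _ _) _.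
    rewrite -addn1; apply: leq_add IH (wlen_gen hG _).
    by rewrite /generators; case: odd => /=; tauto.
  have sum r : (co a b (gamma r)).1.1 + (co a b (gamma r)).1.2 = r%:Z.
    elim: r => [|r IH]; first by rewrite /= co1.
    by rewrite step coM//; case: odd; rewrite ?co_a ?co_b//=; lia.
  have := up (t - s)%N; rewrite subnKC//.
  set g := (_ * _)%g => le.
  case E : (co a b g) => [[i j] k].
  have [low _] := prod_of_length_lower hG (wlenP hG g).1 E.
  have ij : i + j = t%:Z - s%:Z.
    rewrite -(sum t) -(sum s); move: E; rewrite /g coM// coV//.
    by move=> [<- <- _] /=; ring.
  lia.
have often e : infinitely_often (fun t => odd t = e).
  by move=> M; exists (M.*2 + e)%N; [|rewrite oddD odd_double; case: e]; lia.
apply: eventually_psi_cvg; apply: (eventually_psi_xi R hG (N := 0%N)).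
- by move=> t _; rewrite step; case: odd; tauto.
- by move=> M; have [t Mt E] := often false M; exists t => //; rewrite step E.
- by move=> M; have [t Mt E] := often true M; exists t => //; rewrite step E.
Qed.

End Realization.

Section RealizationSigns.
Variables (R : realType) (G : groupType).

Lemma busemann_eta_sign (a b : G) eps m n : is_heisenberg_group a b ->
  is_sign eps ->
  busemann_point (word_dist (generators a b)) (eta_fun R a b eps m n).
Proof.
move=> hG [] ->; last exact: busemann_eta.
have := busemann_eta R (is_heisenberg_invl hG) (- m) n.
by rewrite invl_generators eta_invl// opprK.
Qed.

Lemma busemann_zeta_sign (a b : G) eps m l : is_heisenberg_group a b ->
  is_sign eps ->
  busemann_point (word_dist (generators a b)) (zeta_fun R a b eps m l).
Proof.
move=> hG se.
have := busemann_eta_sign (- m) l (is_heisenberg_swap hG) se.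
by rewrite swap_generators eta_swap// opprK.
Qed.

Lemma busemann_xi_sign (a b : G) e e' : is_heisenberg_group a b ->
  is_sign e -> is_sign e' ->
  busemann_point (word_dist (generators a b)) (xi_fun R a b e e').
Proof.
have left_sign e1 : (forall x y : G, is_heisenberg_group x y ->
      busemann_point (word_dist (generators x y)) (xi_fun R x y 1 e1)) ->
    forall (x y : G) e2, is_heisenberg_group x y -> is_sign e2 ->
      busemann_point (word_dist (generators x y)) (xi_fun R x y e2 e1).
  move=> pos x y e2 hxy [] ->; last exact: pos.
  have := pos _ _ (is_heisenberg_invl hxy).
  by rewrite invl_generators (xi_invl R hxy).
move=> hG se se'; apply: (left_sign) => // x y hxy.
rewrite -(xi_swap R hxy) -swap_generators.
apply: (left_sign) => //; last exact: is_heisenberg_swap.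
by move=> x' y'; apply: busemann_xi.
Qed.

End RealizationSigns.

Unset Implicit Arguments.

Theorem theorem5p4 (R : realType) (G : groupType) (a b : G)
    (hG : is_heisenberg_group a b) (f : {ptws G -> R}) :
  busemann_point (word_dist (generators a b)) f <->
  [\/ exists eps m n : int, is_sign eps /\ f = eta_fun R a b eps m n,
      exists eps m l : int, is_sign eps /\ f = zeta_fun R a b eps m l |
      exists eps_a eps_b : int,
        [/\ is_sign eps_a, is_sign eps_b & f = xi_fun R a b eps_a eps_b]].
Proof.
split.
  move=> /(busemann_pointP hG)[gamma geo cv].
  have [g ev fam] := geodesic_limit R hG geo.
  by rewrite (eventually_psi_unique cv ev).
move=> [[e [m [n [se ->]]]]|[e [m [l [se ->]]]]|[e [e' [se se' ->]]]].
- exact: busemann_eta_sign.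
- exact: busemann_zeta_sign.
- exact: busemann_xi_sign.
Qed.
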